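(* Let $p$ be an odd prime and $t\in\mathbb{N}$ with $1\le t\le p-1$. Let $y_1,\dots,y_{2t}\in\mathbb{Z}_p$, let $f_1=\sum_{j=1}^t a_{j1}x^{\alpha_{j1}}\in\mathbb{Z}[x]$, and let $x_1=\overline{(x_{1k})}_k,\dots,x_{2t}=\overline{(x_{(2t)k})}_k\in\mathbb{Z}_p^\times$ satisfy: (i) $f_1(x_i)\equiv y_i\pmod p$ for $1\le i\le 2t$; (ii) $\det\begin{pmatrix} x_1^{\alpha_{11}}&\cdots&x_1^{\alpha_{t1}}& a_{11}e_2(x_{12})x_1^{\alpha_{11}}&\cdots& a_{t1}e_2(x_{12})x_1^{\alpha_{t1}}\\ \vdots&&\vdots&\vdots&&\vdots\\ x_{2t}^{\alpha_{11}}&\cdots&x_{2t}^{\alpha_{t1}}& a_{11}e_2(x_{(2t)2})x_{2t}^{\alpha_{11}}&\cdots& a_{t1}e_2(x_{(2t)2})x_{2t}^{\alpha_{t1}}\end{pmatrix}\not\equiv 0\pmod p$. Then there exists a unique $f=\sum_{j=1}^t a_jx^{\alpha_j}$ with $a_j\in\mathbb{Z}_p^\times$ and $\alpha_j\in\mathcal{E}_p$ ($1\le j\le t$) such that simultaneously $f(x_i)=y_i$ in $\mathbb{Z}_p$ for $1\le i\le 2t$, and $a_j=\overline{(a_{j1},\dots)}$, $\alpha_j=\overline{(\alpha_{j1},\dots)}$ (i.e. $a_j$ has first coordinate $a_{j1}$ and $\alpha_j$ has first coordinate $\alpha_{j1}$) for $1\le j\le t$.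
   Context: $\mathbb{Z}_p$ is modeled as the set of sequences $(a_k)_{k\in\mathbb{N}}$ of integers with $a_{k+1}\equiv a_k\pmod{p^k}$, modulo $a_k\equiv b_k\pmod{p^k}$ for all $k$, coordinatewise operations; units: $p\nmid a_1$; congruences of elements of $\mathbb{Z}_p$ modulo $p$ refer to first coordinates. $\mathcal{E}_p$ is the set of sequences $(\alpha_k)_{k\in\mathbb{N}}$ of integers with $\alpha_{k+1}\equiv\alpha_k\pmod{\varphi(p^k)}$, modulo $\alpha_k\equiv\beta_k\pmod{\varphi(p^k)}$ for all $k$ ($\varphi$ = Euler's totient). For $a=\overline{(a_k)}\in\mathbb{Z}_p^\times$, $\alpha=\overline{(\alpha_k)}\in\mathcal{E}_p$, $a^\alpha:=\overline{(a_k^{\alpha_k})}$, and for $f=\sum_j a_jx^{\alpha_j}$ and $x\in\mathbb{Z}_p^\times$, $f(x)=\sum_ja_jx^{\alpha_j}\in\mathbb{Z}_p$; integers are embedded in $\mathbb{Z}_p$ and $\mathcal{E}_p$ as constant sequences. $e_2:(\mathbb{Z}/p^2\mathbb{Z})^\times\to\mathbb{Z}/p\mathbb{Z}$ is defined by $x^{p-1}\equiv1+p\,e_2(x)\pmod{p^2}$. *)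

(* Defs.v *)
From HB Require Import structures.
From mathcomp Require Import all_boot all_order all_algebra.
From mathcomp Require Import fingroup cyclic generic_quotient boolp.
Set Implicit Arguments.
Unset Strict Implicit.
Unset Printing Implicit Defensive.
Import GRing.Theory.
Local Open Scope ring_scope.
Local Open Scope quotient_scope.

(* Given moduli m_0, m_1, ..., the sequences of integers (a_k) such that
   a_(k+1) = a_k mod m_k for all k, modulo the relation a_k = b_k mod m_k for
   all k, with coh_coordinatewise operations.  Both instances below have m_0 = 1,
   so that the coh_coordinate of index 0 carries no information and sequences are
   effectively indexed by k >= 1. *)

Definition coherent (m : nat -> nat) (a : nat -> int) : Prop :=
  forall k, (a k.+1 = a k %[mod m k])%Z.

Definition cohseq (m : nat -> nat) := {a : nat -> int | `[< coherent m a >]}.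

HB.instance Definition _ m := Choice.on (cohseq m).

Definition Cohseq m a (h : coherent m a) : cohseq m := exist _ a (asboolT h).

Section CoherentQuotient.
Variable m : nat -> nat.
Implicit Types a b c : cohseq m.

Lemma cohseqP a : coherent m (val a).
Proof. by apply/asboolP; exact: valP a. Qed.

Definition cong_seq a b : bool :=
  `[< forall k, (val a k = val b k %[mod m k])%Z >].

Lemma cong_seq_refl : reflexive cong_seq.
Proof. by move=> a; apply/asboolP. Qed.

Lemma cong_seq_sym : symmetric cong_seq.
Proof. by move=> a b; apply/asboolP/asboolP => h k; rewrite h. Qed.

Lemma cong_seq_trans : transitive cong_seq.
Proof. by move=> b a c /asboolP h1 /asboolP h2; apply/asboolP=> k; rewrite h1. Qed.

Canonical cong_seq_equiv :=
  EquivRel cong_seq cong_seq_refl cong_seq_sym cong_seq_trans.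

Definition cohquot := {eq_quot cong_seq}.

HB.instance Definition _ := Choice.on cohquot.
HB.instance Definition _ := EqQuotient.on cohquot.

Definition cls a : cohquot := \pi_cohquot a.

(* An integer representing the k-th coh_coordinate: only its class modulo m_k is
   meaningful (see coh_coord_cls). *)
Definition coh_coord (x : cohquot) (k : nat) : int := val (repr x) k.

Lemma cls_eqP a b :
  cls a = cls b <-> forall k, (val a k = val b k %[mod m k])%Z.
Proof.
split=> [/eqmodP /asboolP // | h].
by apply/eqmodP/asboolP.
Qed.

Lemma cls_repr (x : cohquot) : cls (repr x) = x.
Proof. exact: reprK. Qed.

Lemma coh_coord_cls a k : (coh_coord (cls a) k = val a k %[mod m k])%Z.
Proof. by move: k; apply/cls_eqP; rewrite cls_repr. Qed.

Lemma coh_coord_coherent (x : cohquot) : coherent m (coh_coord x).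
Proof. exact: cohseqP. Qed.

Lemma cohquotP (x y : cohquot) :
  x = y <-> forall k, (coh_coord x k = coh_coord y k %[mod m k])%Z.
Proof. by rewrite -{1}[x]cls_repr -{1}[y]cls_repr cls_eqP. Qed.

Lemma const_coherent (n : int) : coherent m (fun=> n).
Proof. by []. Qed.

Lemma add_coherent a b : coherent m (fun k => val a k + val b k).
Proof. by move=> k; rewrite -modzDm !cohseqP modzDm. Qed.

Lemma opp_coherent a : coherent m (fun k => - val a k).
Proof. by move=> k; rewrite -modzNm cohseqP modzNm. Qed.

Lemma mul_coherent a b : coherent m (fun k => val a k * val b k).
Proof. by move=> k; rewrite -modzMm !cohseqP modzMm. Qed.

Definition coh_const (n : int) : cohquot := cls (Cohseq (const_coherent n)).
Definition coh_add (x y : cohquot) : cohquot :=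
  cls (Cohseq (add_coherent (repr x) (repr y))).
Definition coh_opp (x : cohquot) : cohquot :=
  cls (Cohseq (opp_coherent (repr x))).
Definition coh_mul (x y : cohquot) : cohquot :=
  cls (Cohseq (mul_coherent (repr x) (repr y))).

Lemma coh_coord_const n k : (coh_coord (coh_const n) k = n %[mod m k])%Z.
Proof. exact: coh_coord_cls. Qed.

Lemma coh_coord_add x y k :
  (coh_coord (coh_add x y) k = coh_coord x k + coh_coord y k %[mod m k])%Z.
Proof. exact: coh_coord_cls. Qed.

Lemma coh_coord_opp x k : (coh_coord (coh_opp x) k = - coh_coord x k %[mod m k])%Z.
Proof. exact: coh_coord_cls. Qed.

Lemma coh_coord_mul x y k :
  (coh_coord (coh_mul x y) k = coh_coord x k * coh_coord y k %[mod m k])%Z.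
Proof. exact: coh_coord_cls. Qed.

Lemma coh_addA : associative coh_add.
Proof.
move=> x y z; apply/cohquotP => k; rewrite !coh_coord_add.
by rewrite -modzDmr coh_coord_add modzDmr -[RHS]modzDml coh_coord_add modzDml addrA.
Qed.

Lemma coh_addC : commutative coh_add.
Proof. by move=> x y; apply/cohquotP => k; rewrite !coh_coord_add addrC. Qed.

Lemma coh_add0 : left_id (coh_const 0) coh_add.
Proof.
move=> x; apply/cohquotP => k.
by rewrite coh_coord_add -modzDml coh_coord_const modzDml add0r.
Qed.

Lemma coh_addN : left_inverse (coh_const 0) coh_opp coh_add.
Proof.
move=> x; apply/cohquotP => k.
by rewrite coh_coord_add -modzDml coh_coord_opp modzDml addNr coh_coord_const.
Qed.

Lemma coh_mulA : associative coh_mul.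
Proof.
move=> x y z; apply/cohquotP => k; rewrite !coh_coord_mul.
by rewrite -modzMmr coh_coord_mul modzMmr -[RHS]modzMml coh_coord_mul modzMml mulrA.
Qed.

Lemma coh_mulC : commutative coh_mul.
Proof. by move=> x y; apply/cohquotP => k; rewrite !coh_coord_mul mulrC. Qed.

Lemma coh_mul1 : left_id (coh_const 1) coh_mul.
Proof.
move=> x; apply/cohquotP => k.
by rewrite coh_coord_mul -modzMml coh_coord_const modzMml mul1r.
Qed.

Lemma coh_mulDl : left_distributive coh_mul coh_add.
Proof.
move=> x y z; apply/cohquotP => k.
rewrite coh_coord_mul -modzMml coh_coord_add modzMml mulrDl.
by rewrite coh_coord_add -[RHS]modzDm !coh_coord_mul modzDm.
Qed.

HB.instance Definition _ := GRing.isZmodule.Build cohquot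
  coh_addA coh_addC coh_add0 coh_addN.
HB.instance Definition _ := GRing.Zmodule_isComPzRing.Build cohquot
  coh_mulA coh_mulC coh_mul1 coh_mulDl.

Lemma coh_constE n : coh_const n = n%:~R.
Proof.
have D i j : coh_const (i + j) = coh_const i + coh_const j.
  by apply/cohquotP => k; rewrite coh_coord_add -[RHS]modzDm !coh_coord_const modzDm.
have N i : coh_const (- i) = - coh_const i.
  by apply/cohquotP => k; rewrite coh_coord_opp -[RHS]modzNm !coh_coord_const modzNm.
elim: n => [//|n IH|n IH].
  by rewrite -addn1 PoszD D IH intrD.
by rewrite -addn1 PoszD !opprD D IH -[X in _ + X]/(coh_const (- 1)) N intrD.
Qed.

End CoherentQuotient.

Definition Zp_adic (p : nat) := cohquot (fun k => p ^ k)%N.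
Definition Ep (p : nat) := cohquot (fun k => totient (p ^ k)).

HB.instance Definition _ p := GRing.ComPzRing.on (Zp_adic p).
HB.instance Definition _ p := Choice.on (Ep p).

Definition Zp_isunit p (x : Zp_adic p) : bool := ~~ (p %| coh_coord x 1)%Z.

Definition Zp_unit (p : nat) := {x : Zp_adic p | Zp_isunit x}.

HB.instance Definition _ p := Choice.on (Zp_unit p).

Definition Zp_eqmodp p (x y : Zp_adic p) : Prop :=
  (coh_coord x 1 = coh_coord y 1 %[mod p])%Z.

(* a ^ e in Z/nZ (n > 1), inverses being taken there when e < 0; the result is
   lifted to an integer. *)
Definition powz_mod (n : nat) (a e : int) : int :=
  nat_of_ord ((a%:~R : 'Z_n) ^ e)%R.

Lemma intr_Zp_val n (a : int) : (1 < n)%N ->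
  (nat_of_ord (a%:~R : 'Z_n))%:Z = (a %% n)%Z.
Proof.
move=> n1; have n0 : n%:Z != 0 by rewrite -lt0n ltnW.
have nZ : (n%:Z)%:~R = 0 :> 'Z_n by rewrite -pmulrn pchar_Zp.
rewrite {1}(divz_eq a n) intrD intrM nZ mulr0 add0r.
have /gez0_abs <- := modz_ge0 a n0.
rewrite -pmulrn val_Zp_nat // modn_small //.
by rewrite -ltz_nat gez0_abs ?modz_ge0 // ltz_pmod // ltz_nat ltnW.
Qed.

Lemma intr_Zp_eqP n (a b : int) : (1 < n)%N ->
  (a%:~R = b%:~R :> 'Z_n) <-> (a = b %[mod n])%Z.
Proof.
move=> n1; split=> [h|h]; first by rewrite -!intr_Zp_val // h.
apply: val_inj => /=; apply/eqP; rewrite -eqz_nat.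
by apply/eqP; rewrite !intr_Zp_val.
Qed.

Lemma unit_Zp_totient n (u : 'Z_n) : (1 < n)%N -> u \is a GRing.unit ->
  u ^+ totient n = 1.
Proof.
move=> n1; rewrite -[u]natr_Zp unitZpE // coprime_sym => /Euler_exp_totient h.
by rewrite -natrX -Zp_nat_mod // h Zp_nat_mod.
Qed.

Lemma unitZpzE n (a : int) : (1 < n)%N ->
  ((a%:~R : 'Z_n) \is a GRing.unit) = coprimez a n.
Proof.
move=> n1; rewrite -[a%:~R]natr_Zp unitZpE // coprime_sym.
have -> : coprime (a%:~R : 'Z_n) n = coprimez (nat_of_ord (a%:~R : 'Z_n)) n.
  by [].
by rewrite intr_Zp_val // /coprimez gcdz_modl.
Qed.

Lemma powz_mod_nat n (a : int) (r : nat) : (1 < n)%N ->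
  (powz_mod n a r = a ^+ r %[mod n])%Z.
Proof.
move=> n1; rewrite /powz_mod -exprnP -rmorphXn /= intr_Zp_val //.
by rewrite modz_mod.
Qed.

Lemma powz_mod_cong n (a b e e' : int) : (1 < n)%N -> coprimez a n ->
  (a = b %[mod n])%Z -> (e = e' %[mod totient n])%Z ->
  powz_mod n a e = powz_mod n b e'.
Proof.
move=> n1 an /(intr_Zp_eqP _ _ n1) ab /eqP; rewrite eqz_mod_dvd => /dvdzP[q eq].
rewrite /powz_mod -ab; have ua : (a%:~R : 'Z_n) \is a GRing.unit by rewrite unitZpzE.
have -> : e = (totient n)%:Z * q + e' by rewrite mulrC -eq subrK.
by rewrite exprzDr // -exprz_exp -exprnP unit_Zp_totient // exp1rz mul1r.
Qed.

Lemma powz_mod_red d n (a b e e' : int) : (1 < d)%N -> (d %| n)%N -> (0 < n)%N ->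
  (totient d %| totient n)%N -> coprimez a n ->
  (a = b %[mod d])%Z -> (e = e' %[mod totient d])%Z ->
  (powz_mod n a e = powz_mod d b e' %[mod d])%Z.
Proof.
move=> d1 dn n0 tdn an ab ee'.
have n1 : (1 < n)%N := leq_trans d1 (dvdn_leq n0 dn).
have tn0 : (totient n)%:Z != 0 by rewrite -lt0n totient_gt0.
have red (u v : int) (k l : nat) : (k %| l)%N -> (u = v %[mod l])%Z -> (u = v %[mod k])%Z.
  move=> kl /eqP; rewrite eqz_mod_dvd => h; apply/eqP.
  by rewrite eqz_mod_dvd; apply: dvdz_trans h.
have ad : coprimez a d by rewrite coprimez_sym (coprimez_dvdl dn) // coprimez_sym.
set r := `|(e %% totient n)%Z|%N.
have rE : r%:Z = (e %% totient n)%Z by rewrite gez0_abs ?modz_ge0.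
rewrite (@powz_mod_cong n a a e r) //; last by rewrite rE modz_mod.
rewrite (red _ _ _ _ dn (powz_mod_nat a r n1)).
rewrite -(powz_mod_nat a r d1) (@powz_mod_cong d a b r e') //.
by rewrite -ee'; apply: red tdn _; rewrite rE modz_mod.
Qed.

Lemma totient_dvd_pfactor p k : prime p ->
  (totient (p ^ k) %| totient (p ^ k.+1))%N.
Proof.
move=> hp; case: k => [|k]; first by rewrite dvd1n.
by rewrite !totient_pfactor //= expnS mulnCA dvdn_mull.
Qed.

Lemma coh_coord_unit p (hp : prime p) (x : Zp_unit p) k :
  coprimez (coh_coord (val x) k.+1) (p ^ k.+1)%N.
Proof.
have h j : (coh_coord (val x) j.+1 = coh_coord (val x) 1 %[mod p])%Z.
  elim: j => [//|j IH]; rewrite -IH.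
  have /eqP := coh_coord_coherent (val x) j.+1; rewrite eqz_mod_dvd => dv.
  apply/eqP; rewrite eqz_mod_dvd; apply: dvdz_trans dv.
  by rewrite dvdzE !absz_nat dvdn_exp.
have := valP x; rewrite /Zp_isunit /= => ux.
rewrite coprimezE /= coprimeXr // coprime_sym prime_coprime //.
have -> : (p %| `|coh_coord (val x) k.+1|)%N = (p %| coh_coord (val x) k.+1)%Z by [].
rewrite (sameP dvdz_mod0P eqP) h.
by rewrite -(sameP dvdz_mod0P eqP).
Qed.

Lemma pow_coherent p (hp : prime p) (x : Zp_unit p) (e : Ep p) :
  coherent (fun k => p ^ k)%N
    (fun k => powz_mod (p ^ k) (coh_coord (val x) k) (coh_coord e k)).
Proof.
move=> [|k]; first by rewrite expn0 !modz1.
have p1 := prime_gt1 hp.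
apply: powz_mod_red.
- by rewrite -(exp1n k.+1) ltn_exp2r.
- by rewrite (expnS p k.+1) dvdn_mull.
- by rewrite expn_gt0 prime_gt0.
- exact: totient_dvd_pfactor.
- exact: coh_coord_unit.
- exact: coh_coord_coherent.
- exact: (coh_coord_coherent e).
Qed.

Definition Zp_pow p (hp : prime p) (x : Zp_unit p) (e : Ep p) : Zp_adic p :=
  cls (Cohseq (pow_coherent hp x e)).

(* x ^ e may be computed from any sequences representing x and e. *)
Lemma coh_coord_Zp_pow p (hp : prime p) (x : Zp_unit p) (e : Ep p)
    (a : cohseq (fun k => p ^ k)%N) (b : cohseq (fun k => totient (p ^ k))) k :
  cls a = val x -> cls b = e ->
  (coh_coord (Zp_pow hp x e) k =
     powz_mod (p ^ k) (val a k) (val b k) %[mod (p ^ k)%N])%Z.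
Proof.
move=> ax be; rewrite coh_coord_cls /=.
case: k => [|k]; first by rewrite expn0 !modz1.
have p1 := prime_gt1 hp.
congr modz; apply: powz_mod_cong.
- by rewrite -(exp1n k.+1) ltn_exp2r.
- exact: coh_coord_unit.
- by rewrite -ax coh_coord_cls.
- by rewrite -be (coh_coord_cls b).
Qed.

Lemma coh_coord_exp p (x : Zp_adic p) n k :
  (coh_coord (x ^+ n) k = coh_coord x k ^+ n %[mod (p ^ k)%N])%Z.
Proof.
elim: n => [|n IH]; first by rewrite !expr0 (coh_coord_const _ 1).
by rewrite !exprS (coh_coord_mul x) -modzMmr IH modzMmr.
Qed.

(* On natural number exponents, x ^ n is the usual power in the ring Z_p. *)
Lemma Zp_pow_nat p (hp : prime p) (x : Zp_unit p) (n : nat) :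
  Zp_pow hp x (coh_const _ n%:Z) = val x ^+ n.
Proof.
apply/cohquotP => k; rewrite (coh_coord_exp (val x)).
rewrite (@coh_coord_Zp_pow p hp x _ (repr (val x)) (Cohseq (@const_coherent _ n)));
  [ | exact: cls_repr | by []].
case: k => [|k]; first by rewrite expn0 !modz1.
by apply: powz_mod_nat; rewrite -(exp1n k.+1) ltn_exp2r // prime_gt1.
Qed.

(* The value at x of the sum over j of a_j X^(alpha_j). *)
Definition fewnomial_eval p (hp : prime p) t (a : 'I_t -> Zp_adic p)
    (alpha : 'I_t -> Ep p) (x : Zp_unit p) : Zp_adic p :=
  \sum_(j < t) a j * Zp_pow hp x (alpha j).

Definition Zp_residue p (x : Zp_adic p) : 'F_p := (coh_coord x 1)%:~R.

Definition Zp_residue2 p (x : Zp_adic p) : 'Z_(p ^ 2) := (coh_coord x 2)%:~R.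

(* Meaningful on units only, where x ^ (p - 1) is congruent to 1 modulo p: see
   e2P. *)
Definition e2 p (x : 'Z_(p ^ 2)) : 'F_p :=
  ((nat_of_ord (x ^+ p.-1)%R).-1 %/ p)%:R.

Lemma e2P p (x : 'Z_(p ^ 2)) : prime p -> x \is a GRing.unit ->
  x ^+ p.-1 = 1 + p%:R * (nat_of_ord (e2 x))%:R.
Proof.
move=> hp; have p1 := prime_gt1 hp; have p0 := prime_gt0 hp.
have pp1 : (1 < p ^ 2)%N by rewrite -(exp1n 2) ltn_exp2r.
rewrite -{1}[x]natr_Zp unitZpE // coprime_sym coprime_pexpr // => xp.
set r := nat_of_ord (x ^+ p.-1).
have r1 : (r = 1 %[mod p])%N.
  have -> : r = (x ^ p.-1 %% p ^ 2)%N.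
    by rewrite /r -{1}[x]natr_Zp -natrX val_Zp_nat.
  rewrite modn_dvdm ?expnS ?dvdn_mulr // -(totient_prime hp).
  exact: Euler_exp_totient.
have r0 : (0 < r)%N.
  by case: r r1 => // /eqP; rewrite mod0n modn_small.
have dr : (p %| r.-1)%N by rewrite -subn1 -eqn_mod_dvd //; apply/eqP.
have rlt : (r < p ^ 2)%N.
  by rewrite /r; case: (x ^+ p.-1) => m /=; rewrite Zp_cast.
have qp : (r.-1 %/ p < p)%N.
  by rewrite ltn_divLR // mulnn (leq_ltn_trans (leq_pred _)).
rewrite /e2 -/r val_Fp_nat // modn_small // -natrM mulnC divnK //.
by rewrite -[LHS]natr_Zp -/r -[1]/(1%:R) -natrD add1n prednK.
Qed.

(* Row i is
   (x_i^alpha_1 ... x_i^alpha_t  a_1 e2(x_i) x_i^alpha_1 ... a_t e2(x_i) x_i^alpha_t)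
   modulo p. *)
Definition interp_matrix p (hp : prime p) t (a : 'I_t -> Zp_adic p)
    (alpha : 'I_t -> Ep p) (x : 'I_(t + t) -> Zp_unit p) : 'M['F_p]_(t + t) :=
  row_mx
    (\matrix_(i < t + t, j < t) Zp_residue (Zp_pow hp (x i) (alpha j)))
    (\matrix_(i < t + t, j < t)
       (Zp_residue (a j) * e2 (Zp_residue2 (val (x i)))
        * Zp_residue (Zp_pow hp (x i) (alpha j)))).

(* Main.v *)
(* Hensel lifting.  For p odd and x a unit, x^phi(p^k) = 1 + p^k e2(x) modulo
   p^(k+1).  Hence, if f = sum_j a_j X^(b_j) interpolates modulo p^k, replacing
   a_j by a_j + p^k u_j and b_j by b_j + phi(p^k) v_j changes f(x_i) modulo
   p^(k+1) by p^k times the i-th entry of M (u, v), where M is the matrix of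
   hypothesis (ii); M depends only on the residues of a_j modulo p and of b_j
   modulo p - 1.  As M is invertible modulo p, exactly one pair (u, v) modulo p
   turns f into an interpolant modulo p^(k+1).  Exponents are represented by
   natural numbers throughout, so that only powers of integers occur. *)
Require Import Defs.
From mathcomp Require Import all_boot all_order all_algebra.
From mathcomp Require Import boolp ring.
Import GRing.Theory.
Local Open Scope ring_scope.

(** * Congruences of integers *)

Lemma eqz_mod_exists (d a b : int) :
  (a = b %[mod d])%Z <-> exists c, a = b + d * c.
Proof.
split=> [/eqP|[c ->]]; last by rewrite mulrC addrC modzMDl.
rewrite eqz_mod_dvd => /dvdzP[c h]; exists c.
by rewrite mulrC -h addrC subrK.
Qed.

Lemma eqz_mod_dvdn (d n : nat) (a b : int) :
  (d %| n)%N -> (a = b %[mod n])%Z -> (a = b %[mod d])%Z.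
Proof.
move=> dn /eqP; rewrite eqz_mod_dvd => h; apply/eqP.
by rewrite eqz_mod_dvd; apply: dvdz_trans h.
Qed.

Lemma eqz_mod_nonneg (d : nat) (a : int) :
  (0 < d)%N -> exists n : nat, (n%:Z = a %[mod d])%Z.
Proof.
move=> d0; have dn : d%:Z != 0 by rewrite -lt0n.
by exists `|(a %% d)%Z|%N; rewrite gez0_abs ?modz_ge0 // modz_mod.
Qed.

Lemma intr_Fp_eqP (p : nat) (a b : int) : prime p ->
  (a%:~R = b%:~R :> 'F_p) <-> (a = b %[mod p])%Z.
Proof. by move=> hp; rewrite intr_Zp_eqP pdiv_id // prime_gt1. Qed.

(** * Powers of integers close to 1 modulo powers of p *)

Lemma expr1D_exists (R : comPzRingType) (q : R) n :
  exists c, (1 + q) ^+ n = 1 + n%:R * q + 'C(n, 2)%:R * q ^+ 2 + q ^+ 3 * c.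
Proof.
elim: n => [|n [c h]]; first by exists 0; rewrite bin0n expr0 /=; ring.
exists (c + 'C(n, 2)%:R + q * c).
by rewrite exprS h binS bin1 natrD -[n.+1]addn1 natrD; ring.
Qed.

(** Oddness gives p | C(p, 2), so the quadratic term of the binomial expansion is divisible by
    p^(2k+3) and the cubic remainder by p^(3k+3). Both vanish modulo p^(k+3), and only the linear
    term survives. *)
Lemma exp_prime_lift (p k : nat) (z e : int) : prime p -> odd p ->
  (z = 1 + (p ^ k.+1)%N%:Z * e %[mod (p ^ k.+2)%N])%Z ->
  (z ^+ p = 1 + (p ^ k.+2)%N%:Z * e %[mod (p ^ k.+3)%N])%Z.
Proof.
move=> hp hodd /eqz_mod_exists[c ->]; apply/eqz_mod_exists.
have [d ->] : exists c', (1 + (p ^ k.+1)%N%:Z * e + (p ^ k.+2)%N%:Z * c) ^+ p =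
   1 + p%:Z * ((p ^ k.+1)%N%:Z * (e + p%:Z * c))
   + 'C(p, 2)%:Z * ((p ^ k.+1)%N%:Z * (e + p%:Z * c)) ^+ 2
   + ((p ^ k.+1)%N%:Z * (e + p%:Z * c)) ^+ 3 * c'.
  have [d hd] := expr1D_exists _ ((p ^ k.+1)%N%:Z * (e + p%:Z * c)) p.
  exists d; move: hd; rewrite !natz => <-; congr (_ ^+ _).
  by rewrite !expnS !PoszM; ring.
have p2 : (2 < p)%N by case: p hp hodd => [|[|[|]]].
have /dvdnP[m ->] : (p %| 'C(p, 2))%N by rewrite prime_dvd_bin.
rewrite !expnS !PoszM; set P := (p ^ k)%N%:Z; set w := e + p%:Z * c.
exists (c + m%:Z * P * w ^+ 2 + P ^+ 2 * w ^+ 3 * d).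
by rewrite /w; ring.
Qed.

Lemma totient_pfactorSS (p k : nat) : prime p ->
  totient (p ^ k.+2) = (totient (p ^ k.+1) * p)%N.
Proof. by move=> hp; rewrite !totient_pfactor //= expnS -mulnA [(p * _)%N]mulnC. Qed.

(** The hypothesis is the case k = 0. Each further level takes a p-th power, since phi(p^(k+2)) = p
    phi(p^(k+1)). *)
Lemma exp_totient_lift (p k : nat) (z e : int) : prime p -> odd p ->
  (z ^+ p.-1 = 1 + p%:Z * e %[mod (p ^ 2)%N])%Z ->
  (z ^+ totient (p ^ k.+1) = 1 + (p ^ k.+1)%N%:Z * e %[mod (p ^ k.+2)%N])%Z.
Proof.
move=> hp hodd h; elim: k => [|k IH].
  by rewrite expn1 totient_prime.
by rewrite totient_pfactorSS // exprM; apply: exp_prime_lift.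
Qed.

(** Expanding the v-th power of 1 + p^(k+1) w, the terms of order at least two are divisible by
    p^(2k+2), hence vanish modulo p^(k+2). *)
Lemma exp_shift_lift (p k b v : nat) (z e : int) : prime p -> odd p ->
  (z ^+ p.-1 = 1 + p%:Z * e %[mod (p ^ 2)%N])%Z ->
  (z ^+ (b + totient (p ^ k.+1) * v) =
    z ^+ b * (1 + (p ^ k.+1)%N%:Z * (e * v%:Z)) %[mod (p ^ k.+2)%N])%Z.
Proof.
move=> hp hodd /(exp_totient_lift _ k _ _ hp hodd) /eqz_mod_exists[c h].
apply/eqz_mod_exists; rewrite exprD exprM h -addrA.
have [d ->] := expr1D_exists _ ((p ^ k.+1)%N%:Z * e + (p ^ k.+2)%N%:Z * c) v.
rewrite !natz !expnS !PoszM; set P := (p ^ k)%N%:Z; set w := e + p%:Z * c.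
exists (z ^+ b * (v%:Z * c + 'C(v, 2)%:Z * P * w ^+ 2 + p%:Z * P ^+ 2 * w ^+ 3 * d)).
by rewrite /w; ring.
Qed.

(** The change is linear in (u, v): the cross terms in [u j * v j] carry the factor p^(2k+2). *)
Lemma sum_shift_lift (p k t : nat) (z e : int) (a u : 'I_t -> int)
    (b v : 'I_t -> nat) : prime p -> odd p ->
  (z ^+ p.-1 = 1 + p%:Z * e %[mod (p ^ 2)%N])%Z ->
  (\sum_j (a j + (p ^ k.+1)%N%:Z * u j) * z ^+ (b j + totient (p ^ k.+1) * v j) =
    \sum_j a j * z ^+ b j
    + (p ^ k.+1)%N%:Z * \sum_j (z ^+ b j * u j + a j * e * z ^+ b j * (v j)%:Z)
   %[mod (p ^ k.+2)%N])%Z.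
Proof.
move=> hp hodd hz; apply/eqz_mod_exists; rewrite mulr_sumr -big_split /=.
apply: (big_ind2 (fun r s => exists c, r = s + (p ^ k.+2)%N%:Z * c)).
- by exists 0; rewrite mulr0 addr0.
- by move=> r s r' s' [c ->] [c' ->]; exists (c + c'); ring.
move=> j _; have /eqz_mod_exists[c ->] := exp_shift_lift _ k (b j) (v j) _ _ hp hodd hz.
rewrite !expnS !PoszM; set P := (p ^ k)%N%:Z.
exists (P * (u j * z ^+ b j * (e * (v j)%:Z)) + a j * c + p%:Z * P * (u j * c)).
by ring.
Qed.

(** * Coordinates of coherent sequences *)

Lemma coh_coord_trans (m : nat -> nat) (x : cohquot m) k l :
  (forall n, m n %| m n.+1)%N -> (k <= l)%N ->
  (coh_coord x l = coh_coord x k %[mod m k])%Z.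
Proof.
move=> hm /subnK <-; elim: (l - k)%N => [//|n IH]; rewrite addSn -IH.
apply: (@eqz_mod_dvdn _ (m (n + k)%N)); last exact: coh_coord_coherent.
elim: n {IH} => [//|n IH]; exact: dvdn_trans IH (hm _).
Qed.

Lemma Zp_coord_trans (p k l : nat) (x : Zp_adic p) : (k <= l)%N ->
  (coh_coord x l = coh_coord x k %[mod (p ^ k)%N])%Z.
Proof. by apply: coh_coord_trans => n; rewrite expnS dvdn_mull. Qed.

Lemma eqz_modX (d x y : int) n : (x = y %[mod d])%Z -> (x ^+ n = y ^+ n %[mod d])%Z.
Proof. by move=> h; rewrite -modzXm h modzXm. Qed.

Lemma coh_coord_sum m (I : Type) (r : seq I) (F : I -> cohquot m) (G : I -> int) k :
  (forall i, (coh_coord (F i) k = G i %[mod m k])%Z) ->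
  (coh_coord (\sum_(i <- r) F i) k = \sum_(i <- r) G i %[mod m k])%Z.
Proof.
move=> h; apply: (big_ind2 (fun a b => (coh_coord a k = b %[mod m k])%Z)) => //.
- exact: (coh_coord_const m 0).
- by move=> a b c d h1 h2; rewrite (coh_coord_add a) -modzDm h1 h2 modzDm.
Qed.

(** * Evaluation at the points and the interpolation matrix *)

Section Interpolation.
Variables (p t : nat) (hp : prime p) (hodd : odd p).

(** By Euler's theorem, exponents at a unit matter only modulo phi(p^(k+1)), so natural
    representatives turn p-adic evaluation into a sum of ordinary integer powers. *)
Lemma coh_coord_fewnomial (a : 'I_t -> Zp_adic p) (alpha : 'I_t -> Ep p)
    (x : Zp_unit p) k (c : 'I_t -> int) (b : 'I_t -> nat) :
  (forall j, (c j = coh_coord (a j) k.+1 %[mod (p ^ k.+1)%N])%Z) ->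
  (forall j, ((b j)%:Z = coh_coord (alpha j) k.+1 %[mod totient (p ^ k.+1)])%Z) ->
  (coh_coord (fewnomial_eval hp a alpha x) k.+1
    = \sum_j c j * coh_coord (val x) k.+1 ^+ b j %[mod (p ^ k.+1)%N])%Z.
Proof.
move=> hc hb; apply: (@coh_coord_sum (fun k => p ^ k)%N) => j.
have p1 : (1 < p ^ k.+1)%N by rewrite -(exp1n k.+1) ltn_exp2r // prime_gt1.
rewrite (coh_coord_mul (a j)) -modzMm -hc.
rewrite (@coh_coord_Zp_pow p hp x _ (repr (val x)) (repr (alpha j))); last 2 first.
- exact: cls_repr.
- exact: cls_repr.
rewrite (@powz_mod_cong _ _ (coh_coord (val x) k.+1) _ (b j)%:Z) //.
- by rewrite powz_mod_nat // modzMm.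
- exact: coh_coord_unit.
Qed.

(** [e2] is read off coordinate 2, but coordinate k+2 serves as well because the two agree modulo
    p^2. *)
Lemma e2_exp (x : Zp_unit p) k :
  (coh_coord (val x) k.+2 ^+ p.-1
    = 1 + p%:Z * (nat_of_ord (e2 (Zp_residue2 (val x))))%:Z %[mod (p ^ 2)%N])%Z.
Proof.
have p1 : (1 < p ^ 2)%N by rewrite -(exp1n 2) ltn_exp2r // prime_gt1.
rewrite (eqz_modX _ _ (coh_coord (val x) 2)); last exact: Zp_coord_trans.
apply/(intr_Zp_eqP _ _ p1); rewrite rmorphXn /= e2P //.
  by rewrite rmorphD rmorphM /= rmorph1 !pmulrn.
by rewrite unitZpzE // coh_coord_unit.
Qed.

Variables (a1 : 'I_t -> int) (alpha1 : 'I_t -> nat) (x : 'I_(t + t) -> Zp_unit p).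

Let M := interp_matrix hp (fun j => coh_const _ (a1 j))
                    (fun j => coh_const _ (alpha1 j)%:Z) x.

Lemma Zp_residue_const n : Zp_residue (coh_const (fun k => p ^ k)%N n) = n%:~R.
Proof.
rewrite /Zp_residue; apply/(intr_Fp_eqP _ _ _ hp).
by have := coh_coord_const (fun k => p ^ k)%N n 1; rewrite expn1.
Qed.

(** By Fermat, only the base modulo p and the exponent modulo p - 1 matter. Hence the same matrix
    [M] governs every level of the lifting. *)
Lemma Zp_residue_pow (z : Zp_unit p) (b b' : nat) k :
  (b%:Z = b'%:Z %[mod totient p])%Z ->
  Zp_residue (Zp_pow hp z (coh_const _ b%:Z)) = (coh_coord (val z) k.+1)%:~R ^+ b'.
Proof.
move=> bb; rewrite /Zp_residue -rmorphXn; apply/(intr_Fp_eqP _ _ _ hp).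
have p1 : (1 < p ^ 1)%N by rewrite expn1 prime_gt1.
have := @coh_coord_Zp_pow p hp z _ (repr (val z)) (Cohseq (@const_coherent _ b%:Z)) 1
  (cls_repr _) erefl.
rewrite expn1 => ->.
rewrite (@powz_mod_cong _ _ (coh_coord (val z) k.+1) _ b'%:Z).
- by rewrite powz_mod_nat ?prime_gt1.
- exact: prime_gt1.
- exact: (coh_coord_unit hp z 0).
- by symmetry; have := @Zp_coord_trans p 1 k.+1 (val z) isT; rewrite expn1.
- by [].
Qed.

(* The coefficient of p^(k+1) in the change of the value at x_i when c is replaced
   by c + p^(k+1) u and b by b + phi(p^(k+1)) v; see approx_eval_shift. *)
Definition shift_coef (n : nat) (c u : 'I_t -> int) (b v : 'I_t -> nat) (i : 'I_(t + t)) :=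
  let z := coh_coord (val (x i)) n in
  let e := (nat_of_ord (e2 (Zp_residue2 (val (x i)))))%:Z in
  \sum_j (z ^+ b j * u j + c j * e * z ^+ b j * (v j)%:Z).

Lemma shift_coefE n (c u : 'I_t -> int) (b v : 'I_t -> nat) i :
  (forall j, (c j = a1 j %[mod p])%Z) ->
  (forall j, ((b j)%:Z = (alpha1 j)%:Z %[mod totient p])%Z) ->
  (shift_coef n.+1 c u b v i)%:~R =
    (M *m col_mx (\col_j (u j)%:~R) (\col_j (v j)%:R)) i 0.
Proof.
move=> hc hb; rewrite /M /interp_matrix mul_row_col !mxE -big_split /= rmorph_sum.
apply: eq_bigr => j _; rewrite !mxE Zp_residue_const.
rewrite (Zp_residue_pow _ _ (b j) n); last by rewrite hb.
rewrite rmorphD !rmorphM !rmorphXn /=.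
have -> : (c j)%:~R = (a1 j)%:~R :> 'F_p by apply/(intr_Fp_eqP _ _ _ hp).
rewrite -!pmulrn natr_Zp; congr (_ + _).
Qed.


Definition approx_eval (n : nat) (c : 'I_t -> int) (b : 'I_t -> nat) (i : 'I_(t + t)) :=
  \sum_j c j * coh_coord (val (x i)) n ^+ b j.

Lemma approx_eval_shift k (c u : 'I_t -> int) (b v : 'I_t -> nat) i :
  (approx_eval k.+2 (fun j => c j + (p ^ k.+1)%N%:Z * u j)%R
     (fun j => b j + totient (p ^ k.+1) * v j)%N i
   = approx_eval k.+2 c b i + (p ^ k.+1)%N%:Z * shift_coef k.+2 c u b v i
   %[mod (p ^ k.+2)%N])%Z.
Proof. exact: sum_shift_lift (e2_exp _ _). Qed.

(** * One lifting step *)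

Hypothesis hdet : \det M != 0.

Let M_unit : M \in unitmx.
Proof. by rewrite unitmxE unitfE. Qed.

Lemma correction_exists k (c : 'I_t -> int) (b : 'I_t -> nat) (z : 'I_(t + t) -> int) :
  (forall j, (c j = a1 j %[mod p])%Z) ->
  (forall j, ((b j)%:Z = (alpha1 j)%:Z %[mod totient p])%Z) ->
  (forall i, (approx_eval k.+1 c b i = z i %[mod (p ^ k.+1)%N])%Z) ->
  exists u v, forall i,
    (approx_eval k.+2 (fun j => c j + (p ^ k.+1)%N%:Z * u j)%R
       (fun j => b j + totient (p ^ k.+1) * v j)%N i = z i %[mod (p ^ k.+2)%N])%Z.
Proof.
move=> hc hb hz.
(* [r i] measures the defect at the next level. The hypothesis uses coordinate k+1 of [x i] and the
   defect coordinate k+2, which is harmless modulo p^(k+1). *)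
have /choice[r hr] : forall i, exists r,
    z i = approx_eval k.+2 c b i + (p ^ k.+1)%N%:Z * r.
  move=> i; apply/eqz_mod_exists; rewrite -hz /approx_eval.
  apply: (big_ind2 (fun r s => (r = s %[mod (p ^ k.+1)%N])%Z)) => //.
    by move=> e f g h h1 h2; rewrite -modzDm h1 h2 modzDm.
  move=> j _; rewrite -modzMmr -[RHS]modzMmr; congr (_ * _ %% _)%Z.
  by apply: eqz_modX; symmetry; apply: Zp_coord_trans.
pose w := invmx M *m \col_i (r i)%:~R.
exists (fun j => (nat_of_ord (w (lshift t j) 0))%:Z), (fun j => nat_of_ord (w (rshift t j) 0)).
move=> i; rewrite approx_eval_shift hr.
set s := shift_coef _ _ _ _ _ _.
have /(intr_Fp_eqP _ _ _ hp)/eqz_mod_exists[d ->] : s%:~R = (r i)%:~R :> 'F_p.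
  rewrite shift_coefE //.
  have -> : col_mx (\col_j (Posz (w (lshift t j) 0))%:~R)
                   (\col_j (nat_of_ord (w (rshift t j) 0))%:R) = w.
    rewrite -[RHS]vsubmxK; congr col_mx; apply/matrixP => j l; rewrite !mxE ord1.
      by rewrite -pmulrn natr_Zp.
    by rewrite natr_Zp.
  by rewrite /w mulKVmx // mxE.
apply/eqz_mod_exists; exists d; rewrite [(p ^ k.+2)%N]expnS PoszM; ring.
Qed.

(** Dividing the change by p^(k+1) puts (u, v) modulo p in the kernel of [M], which is trivial. *)
Lemma correction_unique k (c u : 'I_t -> int) (b v : 'I_t -> nat) :
  (forall j, (c j = a1 j %[mod p])%Z) ->
  (forall j, ((b j)%:Z = (alpha1 j)%:Z %[mod totient p])%Z) ->
  (forall i, (approx_eval k.+2 (fun j => c j + (p ^ k.+1)%N%:Z * u j)%R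
       (fun j => b j + totient (p ^ k.+1) * v j)%N i
     = approx_eval k.+2 c b i %[mod (p ^ k.+2)%N])%Z) ->
  forall j, (p %| u j)%Z /\ (p %| v j)%N.
Proof.
move=> hc hb h.
have P0 : (p ^ k.+1)%N%:Z != 0 by rewrite -lt0n expn_gt0 prime_gt0.
have s0 i : (shift_coef k.+2 c u b v i)%:~R = 0 :> 'F_p.
  have := h i; rewrite approx_eval_shift => /eqP.
  rewrite eqz_mod_dvd [_ + _ - _]addrAC subrr add0r [(p ^ k.+2)%N]expnSr PoszM dvdz_mul2l //.
  move=> /dvdz_mod0P h0; rewrite -[RHS]/(0%:~R); apply/(intr_Fp_eqP _ _ _ hp).
  by rewrite h0 mod0z.
have w0 : col_mx (\col_j (u j)%:~R) (\col_j (v j)%:R) = 0 :> 'cV['F_p]_(t + t).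
  apply: (can_inj (mulKmx M_unit)); rewrite mulmx0; apply/matrixP => i l.
  by rewrite ord1 -(shift_coefE k.+1 c u b v i) // s0 mxE.
move=> j; split.
  have /(congr1 (fun A : 'cV_(t + t) => A (lshift t j) 0)) := w0.
  rewrite col_mxEu !mxE -[RHS]/(0%:~R) => /(intr_Fp_eqP _ _ _ hp).
  by rewrite mod0z => /dvdz_mod0P.
have /(congr1 (fun A : 'cV_(t + t) => A (rshift t j) 0)) := w0.
rewrite col_mxEd !mxE pmulrn -[RHS]/(0%:~R) => /(intr_Fp_eqP _ _ _ hp).
by rewrite mod0z => /dvdz_mod0P.
Qed.

(* Otherwise column t + j of the interpolation matrix vanishes. *)
Lemma interp_unit_coef j : ~~ (p %| a1 j)%Z.
Proof.
apply/negP => /dvdz_mod0P h.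
have /(congr1 (fun A : 'cV_(t + t) => A (rshift t j) 0)) :
    (col_mx 0 (delta_mx j 0) : 'cV['F_p]_(t + t)) = 0.
  apply: (can_inj (mulKmx M_unit)); rewrite mulmx0 /M mul_row_col mulmx0 add0r.
  apply/matrixP => i l; rewrite ord1 !mxE big1 // => j' _; rewrite !mxE.
  case: eqP => [->|]; last by rewrite mulr0.
  rewrite Zp_residue_const.
  have -> : (a1 j)%:~R = 0 :> 'F_p.
    by rewrite -[RHS]/(0%:~R); apply/(intr_Fp_eqP _ _ _ hp); rewrite h mod0z.
  by rewrite !mul0r.
by rewrite col_mxEd !mxE !eqxx => /eqP; rewrite oner_eq0.
Qed.


(** * Existence by iterating the lifting step *)

Lemma interpolation_exists (y : 'I_(t + t) -> Zp_adic p) :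
  (forall i, Zp_eqmodp (fewnomial_eval hp (fun j => coh_const _ (a1 j))
     (fun j => coh_const _ (alpha1 j)%:Z) (x i)) (y i)) ->
  exists f : {ffun 'I_t -> Zp_unit p * Ep p},
    (forall i, fewnomial_eval hp (fun j => val (f j).1) (fun j => (f j).2) (x i) = y i)
    /\ (forall j, (coh_coord (val (f j).1) 1 = a1 j %[mod p])%Z
           /\ (coh_coord (f j).2 1 = (alpha1 j)%:Z %[mod totient p])%Z).
Proof.
move=> hy.
pose inv k (s : ('I_t -> int) * ('I_t -> nat)) :=
  [/\ forall j, (s.1 j = a1 j %[mod p])%Z,
      forall j, ((s.2 j)%:Z = (alpha1 j)%:Z %[mod totient p])%Z &
      forall i, (approx_eval k.+1 s.1 s.2 i = coh_coord (y i) k.+1 %[mod (p ^ k.+1)%N])%Z].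
have inv0 : inv 0%N (a1, alpha1).
  split=> // i; rewrite /approx_eval -(coh_coord_fewnomial (fun j => coh_const _ (a1 j))
     (fun j => coh_const _ (alpha1 j)%:Z)).
  - by have := hy i; rewrite /Zp_eqmodp expn1.
  - by move=> j; rewrite (coh_coord_const (fun k => p ^ k)%N).
  - by move=> j; rewrite (coh_coord_const (fun k => totient (p ^ k))).
have /choice[step hstep] (ks : nat * (('I_t -> int) * ('I_t -> nat))) : exists s',
    inv ks.1 ks.2 -> inv ks.1.+1 s' /\ forall j,
      (s'.1 j = ks.2.1 j %[mod (p ^ ks.1.+1)%N])%Z /\
      ((s'.2 j)%:Z = (ks.2.2 j)%:Z %[mod totient (p ^ ks.1.+1)])%Z.
  case: ks => k [c b] /=.
  (* Choice needs a total step function; where the invariant fails, [(c, b)] is a mere default. *)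
  have [[hc hb hz]|ninv] := pselect (inv k (c, b)); last by exists (c, b).
  have hz' i : (approx_eval k.+1 c b i = coh_coord (y i) k.+2 %[mod (p ^ k.+1)%N])%Z.
    by rewrite (Zp_coord_trans p k.+1 k.+2) // hz.
  have [u [v huv]] := correction_exists k c b _ hc hb hz'.
  exists (fun j => c j + (p ^ k.+1)%N%:Z * u j,
          fun j => (b j + totient (p ^ k.+1) * v j)%N).
  have hu j : (c j + (p ^ k.+1)%N%:Z * u j = c j %[mod (p ^ k.+1)%N])%Z.
    by apply/eqz_mod_exists; exists (u j).
  have hv j : ((b j + totient (p ^ k.+1) * v j)%N%:Z = (b j)%:Z
      %[mod totient (p ^ k.+1)])%Z.
    by apply/eqz_mod_exists; exists (v j)%:Z; rewrite PoszD PoszM.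
  move=> _; split=> //; split=> //= j.
  - by rewrite -hc; apply: eqz_mod_dvdn (hu j); rewrite expnS dvdn_mulr.
  - rewrite -hb; apply: eqz_mod_dvdn (hv j).
    by rewrite totient_pfactor // totient_prime // dvdn_mulr.
pose S := fix S k := if k is k'.+1 then step (k', S k') else (a1, alpha1).
have invS k : inv k (S k) by elim: k => // k /(hstep (k, S k))[].
have cohS k := (hstep (k, S k) (invS k)).2.
(* Index 0 of a coherent sequence carries no information, and S 0 solves the
   system modulo p^1, hence the shift by one. *)
have cohA j : coherent (fun k => p ^ k)%N (fun k => (S k.-1).1 j).
  by case=> [|k]; [rewrite expn0 !modz1 | apply: (cohS k j).1].
have cohB j : coherent (fun k => totient (p ^ k)) (fun k => ((S k.-1).2 j)%:Z).
  by case=> [|k]; [rewrite expn0 !modz1 | apply: (cohS k j).2].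
pose A j : Zp_adic p := cls (Cohseq (cohA j)).
pose B j : Ep p := cls (Cohseq (cohB j)).
have A1 j : (coh_coord (A j) 1 = a1 j %[mod p])%Z.
  by have := coh_coord_cls (Cohseq (cohA j)) 1; rewrite expn1.
have B1 j : (coh_coord (B j) 1 = (alpha1 j)%:Z %[mod totient p])%Z.
  by have := coh_coord_cls (Cohseq (cohB j)) 1; rewrite /= expn1.
have Au j : Zp_isunit (A j).
  rewrite /Zp_isunit (sameP dvdz_mod0P eqP) A1 -(sameP dvdz_mod0P eqP).
  exact: interp_unit_coef.
exists [ffun j => (exist _ (A j) (Au j) : Zp_unit p, B j)]; split=> [i|j]; last first.
  by rewrite ffunE; split; [apply: A1 | apply: B1].
apply/(@cohquotP (fun k => p ^ k)%N) => -[|k]; first by rewrite expn0 !modz1.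
(* Coordinate k+1 of the limit is represented by [S k], which interpolates modulo p^(k+1). *)
have [_ _ <-] := invS k.
apply: coh_coord_fewnomial => j; rewrite ffunE /=.
- by rewrite (coh_coord_cls (Cohseq (cohA j)) k.+1).
- by rewrite (coh_coord_cls (Cohseq (cohB j)) k.+1).
Qed.

(** * Uniqueness, coordinate by coordinate *)

Lemma interpolation_unique (f g : 'I_t -> Zp_adic p * Ep p) :
  (forall i, fewnomial_eval hp (fun j => (f j).1) (fun j => (f j).2) (x i)
    = fewnomial_eval hp (fun j => (g j).1) (fun j => (g j).2) (x i)) ->
  (forall j, (coh_coord (f j).1 1 = a1 j %[mod p])%Z
           /\ (coh_coord (f j).2 1 = (alpha1 j)%:Z %[mod totient p])%Z) ->
  (forall j, (coh_coord (g j).1 1 = a1 j %[mod p])%Z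
           /\ (coh_coord (g j).2 1 = (alpha1 j)%:Z %[mod totient p])%Z) ->
  f =1 g.
Proof.
move=> hfg hf hg.
have tot0 k : (0 < totient (p ^ k))%N by rewrite totient_gt0 expn_gt0 prime_gt0.
suff H k : forall j, (coh_coord (f j).1 k.+1 = coh_coord (g j).1 k.+1 %[mod (p ^ k.+1)%N])%Z
      /\ (coh_coord (f j).2 k.+1 = coh_coord (g j).2 k.+1 %[mod totient (p ^ k.+1)])%Z.
  move=> j; rewrite [f j]surjective_pairing [g j]surjective_pairing; congr pair;
    apply/cohquotP => -[|k]; rewrite ?expn0 ?modz1 //; [exact: (H k j).1|exact: (H k j).2].
elim: k => [|k IH] j.
  by have [h1 h2] := hf j; have [h3 h4] := hg j; rewrite expn1 h1 h2 h3 h4.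
(* Working relative to the approximation of f modulo p^(k+2), f corresponds to the
   correction (0, 0) and g to (u, v). *)
have /choice[b hb] : forall j, exists b : nat,
    (b%:Z = coh_coord (f j).2 k.+2 %[mod totient (p ^ k.+2)])%Z.
  by move=> j'; apply: eqz_mod_nonneg.
pose c j := coh_coord (f j).1 k.+2.
have /choice[u hu] : forall j, exists u,
    coh_coord (g j).1 k.+2 = c j + (p ^ k.+1)%N%:Z * u.
  move=> j'; apply/eqz_mod_exists; rewrite /c.
  by rewrite !(Zp_coord_trans p k.+1 k.+2) // (IH j').1.
have hbk j' : ((b j')%:Z = coh_coord (f j').2 k.+1 %[mod totient (p ^ k.+1)])%Z.
  rewrite -(coh_coord_coherent (f j').2 k.+1); apply: eqz_mod_dvdn (hb j').
  exact: totient_dvd_pfactor.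
have /choice[v hv] : forall j, exists v : nat,
    ((b j + totient (p ^ k.+1) * v)%N%:Z = coh_coord (g j).2 k.+2
       %[mod totient (p ^ k.+2)])%Z.
  move=> j'.
  have /eqz_mod_exists[d hd] : (coh_coord (g j').2 k.+2 = (b j')%:Z
      %[mod totient (p ^ k.+1)])%Z.
    by rewrite hbk (IH j').2; apply: (coh_coord_coherent (g j').2 k.+1).
  (* The quotient [d] may be negative. Replacing it by a natural number congruent to it modulo p
     changes the exponent by a multiple of p phi(p^(k+1)) = phi(p^(k+2)). *)
  have [v hv] := eqz_mod_nonneg p d (prime_gt0 hp).
  exists v; have /eqz_mod_exists[e he] := hv; apply/eqz_mod_exists; exists e.
  by rewrite hd PoszD PoszM he totient_pfactorSS // PoszM; ring.
have [] := correction_unique k c u b v _ _ _ j.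
- move=> j'; rewrite -(hf j').1; rewrite /c.
  by have := Zp_coord_trans p 1 k.+2 (f j').1 isT; rewrite expn1.
- move=> j'; rewrite -(hf j').2.
  have h : ((b j')%:Z = coh_coord (f j').2 k.+2 %[mod totient p])%Z.
    apply: eqz_mod_dvdn (hb j').
    by rewrite totient_pfactor // totient_prime // dvdn_mulr.
  rewrite h; have := @coh_coord_trans (fun k => totient (p ^ k)) (f j').2 1 k.+2.
  by rewrite expn1; apply=> // n; apply: totient_dvd_pfactor.
(* Both sums represent coordinate k+2 of the common value of [f] and [g] at [x i]. *)
- move=> i; rewrite /approx_eval.
  rewrite -(coh_coord_fewnomial (fun j => (f j).1) (fun j => (f j).2) (x i) k.+1 c b) // hfg.
  by symmetry; apply: coh_coord_fewnomial => // j'; rewrite hu.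
(* The extra factor p in u and v raises the agreement from p^(k+1) to p^(k+2), and from phi(p^(k+1))
   to phi(p^(k+2)). *)
move=> /dvdzP[d hd] /dvdnP[e he]; split.
  symmetry; apply/eqz_mod_exists; exists d.
  by rewrite hu hd [(p ^ k.+2)%N]expnSr PoszM; ring.
rewrite -hb -hv; symmetry; apply/eqz_mod_exists; exists e%:Z.
by rewrite he totient_pfactorSS // PoszD !PoszM; ring.
Qed.

End Interpolation.

Theorem theorem2p5 (p t : nat) (hp : prime p) (hodd : odd p)
    (ht : (1 <= t <= p - 1)%N)
    (y : 'I_(t + t) -> Zp_adic p)
    (a1 : 'I_t -> int) (alpha1 : 'I_t -> nat)
    (x : 'I_(t + t) -> Zp_unit p)
    (hy : forall i : 'I_(t + t),
        Zp_eqmodp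
          (fewnomial_eval hp (fun j => coh_const _ (a1 j))
             (fun j => coh_const _ (alpha1 j)%:Z) (x i))
          (y i))
    (hdet : \det (interp_matrix hp (fun j => coh_const _ (a1 j))
                    (fun j => coh_const _ (alpha1 j)%:Z) x) != 0) :
  exists! f : {ffun 'I_t -> Zp_unit p * Ep p},
    (forall i : 'I_(t + t),
        fewnomial_eval hp (fun j => val (f j).1) (fun j => (f j).2) (x i) = y i)
    /\ (forall j : 'I_t,
           (coh_coord (val (f j).1) 1 = a1 j %[mod p])%Z
           /\ (coh_coord (f j).2 1 = (alpha1 j)%:Z %[mod totient p])%Z).
Proof.
have [f [hf1 hf2]] := interpolation_exists p t hp hodd a1 alpha1 x hdet y hy.
exists f; split=> // g [hg1 hg2].
have fg := interpolation_unique p t hp hodd a1 alpha1 x hdet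
  (fun j => (val (f j).1, (f j).2)) (fun j => (val (g j).1, (g j).2))
  (fun i => etrans (hf1 i) (esym (hg1 i))) hf2 hg2.
apply/ffunP => j; have [/val_inj e1 e2] := fg j.
by rewrite [f j]surjective_pairing [g j]surjective_pairing e1 e2.
Qed.
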